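(* Let $\mathbf{x}$ be an infinite word over a finite alphabet which is not ultimately periodic. Then $$ \mathrm{Rep} (\mathbf{x}) \ge \frac{\mathrm{rep} (\mathbf{x}) + 1}{2} + \frac{\sqrt{(\mathrm{rep} (\mathbf{x}))^2 (\mathrm{rep} (\mathbf{x}) - 1)^2 + 4(\mathrm{rep} (\mathbf{x}) - 1)}}{2 \, \mathrm{rep} (\mathbf{x})}. $$
   Context: For an infinite word $\mathbf{x} = x_1 x_2 \dots$ over a finite alphabet and an integer $n \ge 1$, set $$ r(n,\mathbf{x}) = \min \{ m \ge 1 : x_{i} \ldots x_{i+n-1} = x_{m-n+1} \ldots x_{m} \text{ for some } i \text{ in } \{1, \ldots , m-n\} \}, $$ that is, $r(n,\mathbf{x})$ is the length of the smallest prefix of $\mathbf{x}$ containing two (possibly overlapping) occurrences of some word of length $n$. For an infinite word $\mathbf{x}$ which is not ultimately periodic, set $$ \mathrm{rep}(\mathbf{x}) = \liminf_{n \to + \infty} \, \frac{r(n, \mathbf{x})}{n} \quad \text{and} \quad \mathrm{Rep}(\mathbf{x}) = \limsup_{n \to + \infty} \, \frac{r(n, \mathbf{x})}{n}. $$ These are elements of $[1,+\infty]$; if $\mathrm{rep}(\mathbf{x}) = +\infty$, the right-hand side of the inequality is read as $+\infty$. *)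

(* Defs.v *)
From HB Require Import structures.
From mathcomp Require Import all_boot all_order all_algebra.
From mathcomp Require Import all_classical all_reals all_analysis.

Set Implicit Arguments.
Unset Strict Implicit.
Unset Printing Implicit Defensive.

Import Order.TTheory GRing.Theory Num.Theory.

Local Open Scope ring_scope.

(* Infinite words are functions [x : nat -> A] indexed from 0: the letter
   written x_i (i >= 1) on paper is [x i.-1]. *)

Definition ultimately_periodic (A : Type) (x : nat -> A) : Prop :=
  exists N p : nat,
    (0 < p)%N /\ forall k : nat, (N <= k)%N -> x (k + p)%N = x k.

(* The length-n suffix of the length-m prefix of x also occurs at an earlier
   position i < m - n; the truncated subtraction leaves no such i unless
   n < m, so in particular m >= 1. *)
Definition repeats (A : finType) (x : nat -> A) (n m : nat) : bool :=
  [exists i : 'I_(m - n), [forall j : 'I_n, x (i + j)%N == x (m - n + j)%N]].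

Lemma repeats_ex (A : finType) (x : nat -> A) (n : nat) :
  exists m : nat, repeats x n m.
Proof.
pose f (i : 'I_(#|A| ^ n).+1) : {ffun 'I_n -> A} := [ffun j : 'I_n => x (i + j)%N].
have /injectivePn[i [k neq_ik eq_f]] : ~~ injectiveb f.
  apply/negP => /injectiveP/leq_card.
  by rewrite card_ord card_ffun card_ord ltnn.
wlog lt_ik : i k neq_ik eq_f / (i < k)%N.
  move=> W; case: (ltngtP i k) => [lt_ik|lt_ki|/val_inj eq_ik].
  - exact: (W i k).
  - by apply: (W k i) => //; rewrite eq_sym.
  - by rewrite eq_ik eqxx in neq_ik.
exists (k + n)%N; rewrite /repeats addnK.
apply/existsP; exists (Ordinal lt_ik); apply/forallP => j /=.
by move/ffunP/(_ j): eq_f; rewrite !ffunE => ->.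
Qed.

Definition rfun (A : finType) (x : nat -> A) (n : nat) : nat :=
  ex_minn (repeats_ex x n).

(* The term n = 0 is irrelevant for both limits. *)
Definition rquot (R : realType) (A : finType) (x : nat -> A) (n : nat) : \bar R :=
  ((rfun x n)%:R / n%:R)%:E.

Definition rep (R : realType) (A : finType) (x : nat -> A) : \bar R :=
  limn_einf (@rquot R A x).

Definition Rep (R : realType) (A : finType) (x : nat -> A) : \bar R :=
  limn_esup (@rquot R A x).

(* The right-hand side of the inequality as a function of t = rep x, with value
   +oo at t = +oo. Since rep x >= 1, the value chosen at -oo is never used. *)
Definition Rep_bound (R : realType) (t : \bar R) : \bar R :=
  match t with
  | EFin a =>
      ((a + 1) / 2
       + Num.sqrt (a ^+ 2 * (a - 1) ^+ 2 + 4 * (a - 1)) / (2 * a))%:E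
  | +oo%E => +oo%E
  | -oo%E => -oo%E
  end.

(* Main.v *)
Require Import Defs.
From HB Require Import structures.
From mathcomp Require Import all_boot all_order all_algebra.
From mathcomp Require Import all_classical all_reals all_analysis.
From mathcomp Require Import zify lra.

Set Implicit Arguments.
Unset Strict Implicit.
Unset Printing Implicit Defensive.

Import Order.TTheory GRing.Theory Num.Theory.
Import numFieldNormedType.Exports.

Local Open Scope ring_scope.
Local Open Scope classical_set_scope.

(** Write r(n) = n + d(n), where d(n) is the least position, counted from 0,
at which starts a factor of length n that also starts at an earlier position,
and put a = rep - 1, b = Rep - 1.  Squaring shows that the inequality amounts to
b (b - a) (a + 1)^2 >= a ([Rep_bound_le_of_defect]).

The function d is a step function.  A last argument n of one of its steps,
together with the value d of the step, gives a [peak]: the word of length n at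
position d reads as the word p letters earlier, for some period p with
0 < p <= d, and this fails at the next letter.  Along the successive peaks
(n_k, d_k, p_k), roughly a n_k <= d_k and d_(k+1) <= b n_k, because
d_(k+1) = d(n_k + 1).  Two facts restrict the periods.

- [periods_incompatible]: the periods of an earlier peak (n, d, p) and a later
  one (n', d', p') cannot both be short, that is, n < p' or d + n < p + d'.
  Otherwise going back from position d + n by p' then p, or by p then p', leads
  to the same letter, so the coincidence of period p extends beyond its end.
- [rpos_overlap]: on the common part of two consecutive peaks the two
  coincidences combine into a repetition of the earlier occurrences, at position
  d' - min(p, p').  As a repetition of length l starts no earlier than d(l), this
  bounds min(p, p') by (a + 1) d' - a (n + d) ([minn_periods_le]): among any two
  consecutive periods one is short.

The first fact and p <= d give d_(k+1) > n_k, hence b >= 1.  Among three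
consecutive peaks, the short periods of the two consecutive pairs belong to two
different peaks unless the middle period is strictly the smallest; then the next
three peaks will do instead.  Contrasting these two short periods with the first
fact leaves, in the limit, either (a + 1) (b - a) b >= a or
(a + 1) a b + b^2 >= a (a + 1)^2, and each, together with b >= 1, implies the
inequality ([defect_ge0_of_cases]).

To avoid error terms, the estimates are made for numbers slightly below a and
above b, for which the bounds hold exactly from some index on; the inequality
then passes to the limit ([defect_ge0_limit]). *)

(** * Repetitions in an infinite word *)

Section Words.
Variables (A : finType) (x : nat -> A).

Definition shift_eq (d p n : nat) : Prop :=
  forall t, (d <= t < d + n)%N -> x t = x (t - p)%N.

(** With positions counted from 0, this is where the second occurrence starts
in the shortest prefix that contains a repeated factor of length [n]. *)
Definition rpos (n : nat) : nat := (rfun x n - n)%N.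

Lemma rfun_gt n : (n < rfun x n)%N.
Proof.
rewrite /rfun; case: ex_minnP => m /existsP[i _] _.
by have := ltn_ord i; lia.
Qed.

Lemma rposE n : rfun x n = (rpos n + n)%N.
Proof. by rewrite /rpos subnK // ltnW // rfun_gt. Qed.

Lemma rpos_min n d p : (0 < p <= d)%N -> shift_eq d p n -> (rpos n <= d)%N.
Proof.
move=> /andP[p0 pd] E; rewrite /rpos leq_subLR addnC /rfun.
case: ex_minnP => m _; apply; rewrite /repeats addnK.
have lt_i : (d - p < d)%N by lia.
apply/existsP; exists (Ordinal lt_i); apply/forallP => j /=; apply/eqP.
have jn := ltn_ord j.
by rewrite (E (d + j)%N); [congr (x _); lia | lia].
Qed.

Lemma rpos_shift n : exists2 p, (0 < p <= rpos n)%N & shift_eq (rpos n) p n.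
Proof.
rewrite /rpos /rfun; case: ex_minnP => m /existsP[i /forallP E] _.
have im := ltn_ord i; exists (m - n - i)%N; first by lia.
move=> t ht; have jn : (t - (m - n) < n)%N by lia.
have /eqP := E (Ordinal jn) => /= Et.
by rewrite -[in LHS](subnKC (m := m - n) (n := t)) -?Et; [congr (x _)|]; lia.
Qed.

Lemma rpos_mono m n : (m <= n)%N -> (rpos m <= rpos n)%N.
Proof.
move=> mn; have [p pd E] := rpos_shift n; apply: (rpos_min pd) => t ht.
by apply: E; lia.
Qed.

(** If [rpos] stayed below [d], arbitrarily long coincidences would have one of
finitely many shifts [p <= d].  For each such [p] aperiodicity provides a
mismatch beyond [d]; a length that covers all these mismatches is too long. *)
Lemma rpos_unbounded d : ~ ultimately_periodic x -> exists n, (d < rpos n)%N.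
Proof.
move=> hx; have mism p : exists t, (0 < p <= d)%N -> (d <= t)%N /\ x t <> x (t - p)%N.
  have [hp|] := boolP (0 < p <= d)%N; last by exists 0%N.
  apply: boolp.contrapT => no.
  case: hx; exists (d - p)%N, p; split; first by lia.
  move=> k hk; apply/eqP; apply/negPn/negP => /eqP ne; apply: no.
  by exists (k + p)%N => _; rewrite addnK; split => //; lia.
have [f fP] := boolp.choice mism.
(* [f p] is the position of a mismatch for the shift [p]. *)
pose T := \max_(p < d.+1) f p; exists T.+1; rewrite ltnNge; apply/negP => le_d.
have [p hp E] := rpos_shift T.+1.
have pd : (p < d.+1)%N by lia.
have /fP[df] : (0 < p <= d)%N by lia.
have fT : (f p <= T)%N by exact: (@leq_bigmax 'I_d.+1 (fun i => f i) (Ordinal pd)).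
by apply; apply: E; lia.
Qed.

(** A step of [rpos] seen from its right end: [n] is the last length for which
the first repetition is at position [d]. *)
Record peak (d p n : nat) : Prop := Peak {
  peak_pos : rpos n = d;
  peak_jump : (d < rpos n.+1)%N;
  peak_period : (0 < p <= d)%N;
  peak_shift : shift_eq d p n;
  peak_max : x (d + n)%N <> x (d + n - p)%N }.

Lemma peak_above m : ~ ultimately_periodic x ->
  exists n p, (m <= n)%N /\ peak (rpos m) p n.
Proof.
move=> hx; have ex := rpos_unbounded (rpos m) hx.
case: (ex_minnP ex) => -[|n] lt_n min_n.
  by have := rpos_mono (leq0n m); lia.
have mn : (m <= n)%N.
  by rewrite leqNgt; apply/negP => /rpos_mono; lia.
have En : rpos n = rpos m.
  apply/eqP; rewrite eqn_leq (rpos_mono mn) andbT leqNgt; apply/negP => /min_n.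
  by rewrite ltnn.
have [p hp E] := rpos_shift n; rewrite En in hp E.
exists n, p; split=> //; split=> // Emax.
suff : (rpos n.+1 <= rpos m)%N by lia.
apply: (rpos_min hp) => t ht.
have [->//|ne] := eqVneq t (rpos m + n)%N.
by apply: E; lia.
Qed.

Lemma peak_next d p n : ~ ultimately_periodic x -> peak d p n ->
  exists d' p' n', [/\ rpos n.+1 = d', (d < d')%N, (n < n')%N & peak d' p' n'].
Proof.
move=> hx P; have [n' [p' [nn P']]] := peak_above n.+1 hx.
by exists (rpos n.+1), p', n'; split => //; exact: peak_jump P.
Qed.

(** Otherwise the letter at [d + n] equals those at [d + n - p'],
[d + n - p' - p] and [d + n - p], against the maximality of the first peak. *)
Lemma periods_incompatible d p n d' p' n' : peak d p n -> peak d' p' n' ->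
  (d < d')%N -> (n < n')%N -> (n < p')%N \/ (d + n < p + d')%N.
Proof.
move=> [_ _ hp E M] [_ _ hp' E' _] dd nn.
case: (ltnP n p') => [|h1]; first by left.
case: (ltnP (d + n) (p + d')) => [|h2]; first by right.
case: M; rewrite (E' (d + n)%N); last by lia.
rewrite (E (d + n - p')%N); last by lia.
rewrite (E' (d + n - p)%N); last by lia.
by congr (x _); lia.
Qed.

(** A period is at most the position of its peak, so both alternatives of
[periods_incompatible] push the next position beyond [n].  This is what makes
[rfun x n] exceed [2 * n] infinitely often. *)
Lemma peak_len_lt_next d p n d' p' n' : peak d p n -> peak d' p' n' ->
  (d < d')%N -> (n < n')%N -> (n < d')%N.
Proof.
move=> P P' dd nn; have hp := peak_period P; have hp' := peak_period P'.
by have [|] := periods_incompatible P P' dd nn; lia.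
Qed.

(** The common part of the two coincidences, of length [l] at position [d'], also
occurs at [d' - p] and at [d' - p'].  These places differ, since a common period
would extend the first coincidence beyond its end; the later of the two is thus
a repetition of length [l]. *)
Lemma rpos_overlap d p n d' p' n' l : peak d p n -> peak d' p' n' ->
  (d < d')%N -> (n < n')%N -> (d' + l = d + n)%N ->
  (rpos l + minn p p' <= d')%N.
Proof.
move=> [_ _ hp E M] [_ _ hp' E' _] dd nn el.
have same t : (d' <= t < d' + l)%N -> x (t - p)%N = x (t - p')%N.
  by move=> ht; rewrite -E -?E' //; lia.
have [lt_pp|lt_pp|eq_pp] := ltngtP p p'.
- suff : (rpos l <= d' - p)%N by lia.
  apply: (@rpos_min _ _ (p' - p)%N); first by lia.
  move=> t ht; have := same (t + p)%N; rewrite addnK => ->; last by lia.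
  by congr (x _); lia.
- suff : (rpos l <= d' - p')%N by lia.
  apply: (@rpos_min _ _ (p - p')%N); first by lia.
  move=> t ht; have := same (t + p')%N; rewrite addnK => <-; last by lia.
  by congr (x _); lia.
- by case: M; rewrite eq_pp; apply: E'; lia.
Qed.

(** When [p1] is not strictly the smallest, the smaller period of the first pair
and that of the second pair can be taken at two different peaks, to which
[periods_incompatible] applies; its conclusion is then weakened to the extreme
values [n0] and [d2]. *)
Lemma small_periods_clash d0 p0 n0 d1 p1 n1 d2 p2 n2 :
  peak d0 p0 n0 -> peak d1 p1 n1 -> peak d2 p2 n2 ->
  (d0 < d1 < d2)%N -> (n0 < n1 < n2)%N -> (p0 <= p1)%N || (p2 <= p1)%N ->
  (n0 < minn p1 p2)%N \/ (d0 + n0 < minn p0 p1 + d2)%N.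
Proof.
move=> P0 P1 P2 hd hn /orP hp.
have F01 := periods_incompatible P0 P1; have F02 := periods_incompatible P0 P2.
have F12 := periods_incompatible P1 P2.
have := (peak_period P0, peak_period P1, peak_period P2).
case: (leqP p0 p1) hp => h01 hp; case: (leqP p1 p2) => h12; lia.
Qed.

End Words.

(** * The algebraic inequality *)

Section Algebra.
Variable R : realType.
Implicit Types a b : R.

(** The claim without its square root: for [a = rep - 1] and [b = Rep - 1], the
bound holds exactly when this quantity is nonnegative. *)
Definition defect a b : R := b * (b - a) * (a + 1) ^+ 2 - a.

(** The first alternative gives the claim at once.  Under the second one, if
[a ^+ 2 * (a + 1) <= 1] then [1 <= b] suffices; if not, compare [b] with
[c = a * (1 + (a + 1) ^- 2)].  For [b >= c] the defect is at least
its value at [c], which is [a * (a ^+ 2 * (a + 1) - 1) / (a + 1) ^+ 2].  For [b < c], replace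
[b ^+ 2] in the defect by its lower bound from the second alternative: the
resulting affine decreasing function of [b] vanishes at [c]. *)
Lemma defect_ge0_of_cases a b : 0 < a -> a <= b -> 1 <= b ->
  a <= (a + 1) * (b - a) * b \/ a * (a + 1) ^+ 2 <= (a + 1) * a * b + b ^+ 2 ->
  0 <= defect a b.
Proof.
move=> a0 ab b1 [I|II]; rewrite /defect.
  have h : 0 <= a * ((a + 1) * (b - a) * b) by rewrite !mulr_ge0 //; lra.
  nra.
have [small|big] := lerP (a ^+ 2 * (a + 1)) 1.
  have h1 : 0 <= (b - 1) * (b + 1 - a) * (a + 1) ^+ 2.
    by rewrite !mulr_ge0 ?sqr_ge0 //; lra.
  nra.
(* The comparison of [b] with [c], cleared of denominators. *)
set t := a + 1; have t0 : 0 < t ^+ 2 by rewrite exprn_gt0 // /t; lra.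
have [above|below] := lerP (a * (t ^+ 2 + 1)) (b * t ^+ 2).
  have : a * (t ^+ 2 * (b - a)) <= b * (t ^+ 2 * (b - a)).
    by rewrite ler_wpM2r // mulr_ge0 //; lra.
  have : a * a <= a * (t ^+ 2 * (b - a)) by rewrite ler_wpM2l //; lra.
  have : b * a <= b * (t ^+ 2 * (b - a)) by rewrite ler_wpM2l //; lra.
  have : (a * (a * (t ^+ 2 + 1))) <= a * (b * t ^+ 2) by rewrite ler_wpM2l //; lra.
  have : 0 <= a * (a ^+ 2 * (a + 1) - 1) by rewrite mulr_ge0 //; lra.
  rewrite -(pmulr_rge0 _ t0) /t; nra.
have h1 : 0 <= t ^+ 2 * ((a + 1) * a * b + b ^+ 2 - a * t ^+ 2).
  by apply: mulr_ge0; [exact: ltW | rewrite /t; lra].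
have h2 : 0 <= a * (a + 2) * (a * (t ^+ 2 + 1) - b * t ^+ 2).
  by rewrite !mulr_ge0 //; lra.
by rewrite /t in h1 h2 *; nra.
Qed.

Lemma Rep_bound_le_of_defect a b : 0 <= a -> a <= b -> 0 <= defect a b ->
  (a + 1 + 1) / 2
    + Num.sqrt ((a + 1) ^+ 2 * (a + 1 - 1) ^+ 2 + 4 * (a + 1 - 1)) / (2 * (a + 1))
  <= b + 1.
Proof.
rewrite /defect => a0 ab g; set S := Num.sqrt _.
have h : S <= (2 * b - a) * (a + 1).
  have nn : 0 <= (2 * b - a) * (a + 1) by rewrite mulr_ge0 //; lra.
  by rewrite -(ger0_norm nn) -sqrtr_sqr ler_wsqrtr //; lra.
have : S / (2 * (a + 1)) <= (2 * b - a) / 2.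
  rewrite ler_pdivrMr; last by lra.
  by apply: le_trans h _; lra.
lra.
Qed.

Lemma defect_ge0_limit a b : 0 < a ->
  (forall e, 0 < e < a -> 0 <= defect (a - e) (b + e)) ->
  0 <= defect a b.
Proof.
move=> a0 H.
have c : (fun e : R => defect (a - e) (b + e)) @ 0^'+ --> defect (a - 0) (b + 0).
  apply: cvg_at_right_filter; rewrite /defect.
  have c0 : (fun e : R => e) @ (0 : R) --> (0 : R) by exact: cvg_id.
  have ca : (fun e => a - e) @ (0 : R) --> a - 0.
    by apply: cvgB => //; exact: cvg_cst.
  have cb : (fun e => b + e) @ (0 : R) --> b + 0.
    by apply: cvgD => //; exact: cvg_cst.
  have ca1 : (fun e => a - e + 1) @ (0 : R) --> a - 0 + 1.
    by apply: cvgD => //; exact: cvg_cst.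
  apply: cvgB (ca); apply: cvgM; last exact: cvgM (ca1) (ca1).
  by apply: cvgM (cb) _; exact: cvgB.
rewrite subr0 addr0 in c; apply: (cvgr_to_ge c).
near=> e; apply: H; apply/andP; split; near: e.
  exact: nbhs_right_gt.
exact: nbhs_right_lt.
Unshelve. all: by end_near.
Qed.

Lemma limn_einf_eventually (u : (\bar R)^nat) c : (c%:E < limn_einf u)%E ->
  exists N, forall n, (N <= n)%N -> (c%:E < u n)%E.
Proof.
rewrite limn_einf_lim (cvg_lim _ (@cvg_einfs_sup _ u)) //.
move=> /ereal_sup_gt[_ [N _ <-] h]; exists N => n Nn; apply: lt_le_trans h _.
by apply: ereal_inf_lbound; exists n.
Qed.

Lemma limn_esup_eventually (u : (\bar R)^nat) c : (limn_esup u < c%:E)%E ->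
  exists N, forall n, (N <= n)%N -> (u n < c%:E)%E.
Proof.
rewrite limn_esup_lim (cvg_lim _ (@cvg_esups_inf _ u)) //.
move=> /ereal_inf_lt[_ [N _ <-] h]; exists N => n Nn; apply: le_lt_trans h.
by apply: ereal_sup_ubound; exists n.
Qed.

Lemma limn_einf_ge (u : (\bar R)^nat) (c : \bar R) N :
  (forall n, (N <= n)%N -> (c <= u n)%E) -> (c <= limn_einf u)%E.
Proof.
move=> h; rewrite limn_einf_lim (cvg_lim _ (@cvg_einfs_sup _ u)) //.
apply: (@le_trans _ _ (einfs u N)); last by apply: ereal_sup_ubound; exists N.
by apply: le_ereal_inf_tmp => _ [n Nn <-]; exact: h.
Qed.

End Algebra.

(** * Estimates along the peaks *)

Section Estimates.
Variables (R : realType) (A : finType) (x : nat -> A).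
Implicit Types a B : R.

Definition rpos_bounds a B (N : nat) : Prop :=
  forall n, (N <= n)%N ->
  a * n%:R <= (rpos x n)%:R /\ (rpos x n.+1)%:R <= B * n%:R.

(** This is [rpos_overlap] combined with [a * l <= rpos x l] for the length
[l = d + n - d'] of the common part.  Since [d' <= B * n], this length is at
least [(a + 1 - B) * n]; the hypothesis on [n] makes it large enough for the
lower bound on [rpos x l] to be available. *)
Lemma minn_periods_le a B n1 d p n d' p' n' :
  0 < a -> B < a + 1 -> rpos_bounds a B n1 ->
  (n1 <= n)%N -> n1%:R <= (a + 1 - B) * n%:R ->
  peak x d p n -> peak x d' p' n' -> rpos x n.+1 = d' -> (d < d')%N -> (n < n')%N ->
  (minn p p')%:R <= (a + 1) * d'%:R - a * (n%:R + d%:R).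
Proof.
move=> a0 Ba hD n1n hn P P' E dd nn.
have [ad dB] := hD _ n1n; rewrite (peak_pos P) in ad; rewrite E in dB.
have n1_ge0 : 0 <= n1%:R :> R by exact: ler0n.
have le_d' : (d' <= d + n)%N by rewrite -(ler_nat R) natrD; lra.
pose l := (d + n - d')%N; have El : (d' + l = d + n)%N by rewrite subnKC.
have ElR : d'%:R + l%:R = d%:R + n%:R :> R by rewrite -!natrD El.
have n1l : (n1 <= l)%N by rewrite -(ler_nat R); lra.
have := rpos_overlap P P' dd nn El; rewrite -(ler_nat R) natrD => h.
have [al _] := hD _ n1l.
have : a * l%:R = a * (d%:R + n%:R - d'%:R) by rewrite -ElR; congr (_ * _); lra.
lra.
Qed.

(** The two outcomes of [small_periods_clash] yield the two alternatives of
[defect_ge0_of_cases], after [a * m1 <= d1 <= B * m0] is used to express every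
quantity in terms of [m0]. *)
Lemma defect_ge0_of_triple a B n1 d0 p0 m0 d1 p1 m1 d2 p2 m2 :
  0 < a -> B < a + 1 -> rpos_bounds a B n1 ->
  (n1 <= m0)%N -> (0 < m0)%N -> n1%:R <= (a + 1 - B) * m0%:R ->
  peak x d0 p0 m0 -> peak x d1 p1 m1 -> peak x d2 p2 m2 ->
  rpos x m0.+1 = d1 -> rpos x m1.+1 = d2 -> (d0 < d1 < d2)%N -> (m0 < m1 < m2)%N ->
  (p0 <= p1)%N || (p2 <= p1)%N -> 0 <= defect a B.
Proof.
move=> a0 Ba hD n1m m00 hm P0 P1 P2 E1 E2 hd hM hp.
have /andP[d01 d12] := hd; have /andP[m01 m12] := hM.
have n1m1 : (n1 <= m1)%N by lia.
have m01R : m0%:R <= m1%:R :> R by rewrite ler_nat ltnW.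
have m0R : 0 < m0%:R :> R by rewrite ltr0n.
have hm1 : n1%:R <= (a + 1 - B) * m1%:R.
  by apply: le_trans hm _; apply: ler_wpM2l; rewrite // subr_ge0 ltW.
have Q0 := minn_periods_le a0 Ba hD n1m hm P0 P1 E1 d01 m01.
have Q1 := minn_periods_le a0 Ba hD n1m1 hm1 P1 P2 E2 d12 m12.
have [ad0 dB1] := hD _ n1m; have [ad1 dB2] := hD _ n1m1.
rewrite (peak_pos P0) E1 in ad0 dB1; rewrite (peak_pos P1) E2 in ad1 dB2.
have d01R : d0%:R <= d1%:R :> R by rewrite ler_nat ltnW.
have aB : a <= B by rewrite -(ler_pM2r m0R); lra.
have B1 : 1 <= B.
  have := peak_len_lt_next P0 P1 d01 m01.
  by rewrite -(ltr_nat R) -(ler_pM2r m0R); lra.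
apply: defect_ge0_of_cases => //.
case: (small_periods_clash P0 P1 P2 hd hM hp); rewrite -(ltr_nat R) ?natrD => h.
  left; rewrite -(ler_pM2r m0R).
  have h1 : m0%:R <= (a + 1) * (B - a) * m1%:R.
    have : (a + 1) * d2%:R <= (a + 1) * (B * m1%:R) by rewrite ler_wpM2l //; lra.
    have : a * (a * m1%:R) <= a * d1%:R by rewrite ler_wpM2l //; lra.
    lra.
  have : a * m0%:R <= a * ((a + 1) * (B - a) * m1%:R) by rewrite ler_wpM2l //; lra.
  have : (a + 1) * (B - a) * (a * m1%:R) <= (a + 1) * (B - a) * (B * m0%:R).
    by rewrite ler_wpM2l //; [apply: mulr_ge0; lra | lra].
  lra.
right; rewrite -(ler_pM2r m0R).
have h1 : (a + 1) * (d0%:R + m0%:R) <= (a + 1) * d1%:R + d2%:R by lra.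
have : a * ((a + 1) * (d0%:R + m0%:R)) <= a * ((a + 1) * d1%:R + d2%:R).
  by rewrite ler_wpM2l //; lra.
have : a * (a + 1) * (a * m0%:R) <= a * (a + 1) * d0%:R.
  by rewrite ler_wpM2l //; apply: mulr_ge0; lra.
have : a * (a + 1) * d1%:R <= a * (a + 1) * (B * m0%:R).
  by rewrite ler_wpM2l //; apply: mulr_ge0; lra.
have : a * d2%:R <= a * (B * m1%:R) by rewrite ler_wpM2l //; lra.
have : B * (a * m1%:R) <= B * (B * m0%:R) by rewrite ler_wpM2l //; lra.
lra.
Qed.

(** Four consecutive peaks suffice: if the second period is strictly smaller
than its two neighbours, then the third one exceeds the second, and the last
three peaks qualify. *)
Lemma defect_ge0_of_bounds a B n1 : ~ ultimately_periodic x ->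
  0 < a -> B < a + 1 -> rpos_bounds a B n1 -> 0 <= defect a B.
Proof.
move=> hx a0 Ba hD.
have aB0 : 0 < a + 1 - B by lra.
pose K := Num.bound (n1%:R / (a + 1 - B)).
have hK m : (K <= m)%N -> n1%:R <= (a + 1 - B) * m%:R.
  rewrite -(ler_nat R) mulrC -ler_pdivrMr // => /(le_trans _); apply; apply/ltW.
  by apply: archi_boundP; rewrite divr_ge0 // ltW.
pose M := (n1 + K).+1.
have [m0 [p0 [Mm0 P0]]] := peak_above M hx.
have [d1 [p1 [m1 [E1 d01 m01 P1]]]] := peak_next hx P0.
have [d2 [p2 [m2 [E2 d12 m12 P2]]]] := peak_next hx P1.
have [up|down] := boolP ((p0 <= p1)%N || (p2 <= p1)%N).
  apply: (defect_ge0_of_triple a0 Ba hD _ _ _ P0 P1 P2); rewrite ?d01 ?m01 //.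
  - lia.
  - lia.
  - by apply: hK; lia.
have [d3 [p3 [m3 [E3 d23 m23 P3]]]] := peak_next hx P2.
apply: (defect_ge0_of_triple a0 Ba hD _ _ _ P1 P2 P3); rewrite ?d12 ?m12 //.
- lia.
- lia.
- by apply: hK; lia.
- lia.
Qed.

End Estimates.

Lemma rposE_rquot (R : realType) (A : finType) (x : nat -> A) n : (0 < n)%N ->
  rquot R x n = (1 + (rpos x n)%:R / n%:R)%:E.
Proof.
move=> n0; rewrite /rquot rposE natrD mulrDl addrC divff //.
by rewrite pnatr_eq0 -lt0n.
Qed.

(** The inequality for [a - e] and [b + e].  When these differ by at least 1 it
is immediate; otherwise [rpos_bounds] holds from some index on, where the slack
between [b + e / 2] and [b + e] absorbs the passage from [n.+1] to [n]. *)
Lemma defect_ge0_of_limits (R : realType) (A : finType) (x : nat -> A) (a b : R) :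
  ~ ultimately_periodic x -> 0 < a -> a <= b ->
  rep R x = (1 + a)%:E -> Rep R x = (1 + b)%:E -> 0 <= defect a b.
Proof.
move=> hx a0 ab Ea Eb; apply: defect_ge0_limit => // e /andP[e0 ea].
have [big|small] := lerP (a - e + 1) (b + e).
  have : 0 <= (b + e - (a - e + 1)) * (b + e + 1) by apply: mulr_ge0; lra.
  rewrite /defect; set a' := a - e; set B := b + e => h.
  have h1 : 1 * 1 <= (B - a') * (a' + 1) ^+ 2.
    by apply: ler_pM => //; [rewrite /B /a'; lra | rewrite exprn_ege1 // /a'; lra].
  have : B * 1 <= B * ((B - a') * (a' + 1) ^+ 2).
    by apply: ler_wpM2l; [rewrite /B; lra | rewrite mulr1 in h1].
  by rewrite /a' /B in big h1 *; lra.
have [N1 h1] : exists N, forall n, (N <= n)%N -> ((1 + (a - e))%:E < rquot R x n)%E.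
  by apply: limn_einf_eventually; rewrite -/(rep R x) Ea lte_fin; lra.
have [N2 h2] : exists N, forall n, (N <= n)%N -> (rquot R x n < (1 + (b + e / 2))%:E)%E.
  by apply: limn_esup_eventually; rewrite -/(Rep R x) Eb lte_fin; lra.
pose K := Num.bound ((b + e / 2) / (e / 2)).
apply: (@defect_ge0_of_bounds _ _ x _ _ (N1 + N2 + K).+1 hx) => //; first by lra.
move=> n hn; have n0 : 0 < n%:R :> R by rewrite ltr0n; lia.
split.
  have := h1 n; rewrite rposE_rquot; last by lia.
  rewrite lte_fin ltrD2l ltr_pdivlMr // => h; apply/ltW/h; lia.
have := h2 n.+1; rewrite rposE_rquot // lte_fin ltrD2l ltr_pdivrMr // => h.
have : (b + e / 2) / (e / 2) < n%:R.
  apply: (@lt_le_trans _ _ K%:R); last by rewrite ler_nat; lia.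
  by apply: archi_boundP; rewrite divr_ge0 //; lra.
rewrite ltr_pdivrMr; last by lra.
move=> hKn; have /h : (N2 <= n.+1)%N by lia.
rewrite -(natr1 n) => hr; apply: ltW; apply: lt_le_trans hr _; lra.
Qed.

Theorem proposition1p6 (R : realType) (A : finType) (x : nat -> A)
    (hx : ~ ultimately_periodic x) :
  (Rep_bound (rep R x) <= Rep R x)%E.
Proof.
have le_rep : (rep R x <= Rep R x)%E := limn_einf_sup _.
have rep1 : (1%:E <= rep R x)%E.
  apply: (@limn_einf_ge _ _ _ 1) => n n0.
  by rewrite rposE_rquot // lee_fin lerDl divr_ge0.
case Er : (rep R x) le_rep rep1 => [r| |] //=.
case Es : (Rep R x) => [s| |] //=; last by move=> _ _; rewrite leey.
rewrite !lee_fin => rs r1.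
have Er1 : r = r - 1 + 1 by rewrite subrK.
have Es1 : s = s - 1 + 1 by rewrite subrK.
rewrite Er1 [leRHS]Es1; apply: Rep_bound_le_of_defect; [lra|lra|].
have [->|r_ne1] := eqVneq r 1.
  by rewrite /defect !subrr subr0 add0r expr1n mulr1 mulr_ge0 //; lra.
apply: (@defect_ge0_of_limits _ _ x) => //.
- by rewrite subr_gt0 lt_neqAle eq_sym r_ne1.
- lra.
- by rewrite Er addrC subrK.
- by rewrite Es addrC subrK.
Qed.
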